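(* Let $\mathbb{C}$ be a category with finite limits, let $H:\mathbb{M}\to\mathbb{C}$ be the inclusion of a full reflective subcategory, with reflector (left adjoint) $I:\mathbb{C}\to\mathbb{M}$ and unit $\eta:1_{\mathbb{C}}\to HI$. Let $U:\mathbb{C}\to\mathbf{Set}$ be a functor such that: (a) $U$ preserves finite limits; (b) $UH$ reflects isomorphisms; (c) $U(\eta_C):U(C)\to UHI(C)$ is surjective for every object $C\in\mathbb{C}$; (d) for every object $M\in\mathbb{M}$ and $T$ a terminal object of $\mathbb{C}$, the map $\mathbb{C}(T,M)\to\mathbf{Set}(U(T),U(M))$, $f\mapsto U(f)$, is surjective. Assume moreover: (e) for every object $C\in\mathbb{C}$, the map $I_{T,C}:\mathbb{C}(T,C)\to\mathbb{M}(T,I(C))$, $f\mapsto I(f)$, is surjective, where $T=HI(T)$ is a terminal object of $\mathbb{C}$. Then the reflection $I\dashv H$ is semi-left-exact if and only if it is simple.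
   Context: Semi-left-exact (also called admissible): the reflection $I\dashv H$ is semi-left-exact if $I$ preserves all pullback squares obtained by pulling back a morphism $g:M\to HI(C)$, with $M\in\mathbb{M}$, along a unit morphism $\eta_C:C\to HI(C)$, for all $C\in\mathbb{C}$. Simple: the reflection $I\dashv H$ is simple if, for every morphism $f:A\to B$ in $\mathbb{C}$, the morphism $I(w):I(A)\to I(P)$ is an isomorphism, where $P=B\times_{HI(B)}HI(A)$ is the pullback of $HI(f):HI(A)\to HI(B)$ along $\eta_B:B\to HI(B)$ and $w:A\to P$ is the unique morphism whose composites with the projections to $B$ and $HI(A)$ are $f$ and $\eta_A$ respectively. Conventions: objects of $\mathbb{M}$ are regarded as objects of $\mathbb{C}$ via $H$. Without loss of generality, the unit is chosen so that the counit is an identity, $IH=1_{\mathbb{M}}$, and the terminal object $T$ of $\mathbb{C}$ is chosen in $\mathbb{M}$ (so $HI(T)=T$). *)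

(* Defs.v *)
From Stdlib Require Export FinFun.

Set Implicit Arguments.
Unset Strict Implicit.

Declare Scope cat_scope.
Open Scope cat_scope.

Record Category := {
  Ob :> Type;
  Hom : Ob -> Ob -> Type;
  id : forall X, Hom X X;
  comp : forall X Y Z, Hom Y Z -> Hom X Y -> Hom X Z;
  comp_assoc : forall X Y Z W (h : Hom Z W) (g : Hom Y Z) (f : Hom X Y),
    comp h (comp g f) = comp (comp h g) f;
  comp_id_l : forall X Y (f : Hom X Y), comp (id Y) f = f;
  comp_id_r : forall X Y (f : Hom X Y), comp f (id X) = f
}.

Arguments Hom {c} _ _.
Arguments id {c} X.
Arguments comp {c X Y Z} _ _.

Notation "g ∘ f" := (comp g f) (at level 40, left associativity) : cat_scope.

Record Functor (C D : Category) := {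
  fobj :> C -> D;
  fmap : forall X Y, Hom X Y -> Hom (fobj X) (fobj Y);
  fmap_id : forall X, fmap (id X) = id (fobj X);
  fmap_comp : forall X Y Z (g : Hom Y Z) (f : Hom X Y),
    fmap (g ∘ f) = fmap g ∘ fmap f
}.

Arguments fmap {C D} f {X Y} _ : rename.

Definition functor_id (C : Category) : Functor C C :=
  {| fobj := fun X => X;
     fmap := fun X Y f => f;
     fmap_id := fun X => eq_refl;
     fmap_comp := fun X Y Z g f => eq_refl |}.

Program Definition functor_comp (C D E : Category)
    (G : Functor D E) (F : Functor C D) : Functor C E :=
  {| fobj := fun X => G (F X);
     fmap := fun X Y f => fmap G (fmap F f) |}.
Next Obligation. now rewrite !fmap_id. Qed.
Next Obligation. now rewrite !fmap_comp. Qed.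

Record NatTrans (C D : Category) (F G : Functor C D) := {
  component :> forall X, Hom (F X) (G X);
  naturality : forall X Y (f : Hom X Y),
    component Y ∘ fmap F f = fmap G f ∘ component X
}.

Record Adjunction (C D : Category) (L : Functor C D) (R : Functor D C) := {
  unit : NatTrans (functor_id C) (functor_comp R L);
  counit : NatTrans (functor_comp L R) (functor_id D);
  triangle_l : forall X, counit (L X) ∘ fmap L (unit X) = id (L X);
  triangle_r : forall Y, fmap R (counit Y) ∘ unit (R Y) = id (R Y)
}.

(* The category of sets: types, with functions compared by Leibniz equality. *)
Definition SET : Category :=
  {| Ob := Type;
     Hom := fun A B => A -> B;
     id := fun A x => x;
     comp := fun A B D g f x => g (f x);
     comp_assoc := fun A B D E h g f => eq_refl;
     comp_id_l := fun A B f => eq_refl;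
     comp_id_r := fun A B f => eq_refl |}.

Definition full_subcategory (C : Category) (P : C -> Prop) : Category :=
  {| Ob := {X : C | P X};
     Hom := fun X Y => @Hom C (proj1_sig X) (proj1_sig Y);
     id := fun X => id (proj1_sig X);
     comp := fun X Y Z g f => comp g f;
     comp_assoc := fun X Y Z W h g f => comp_assoc h g f;
     comp_id_l := fun X Y f => comp_id_l f;
     comp_id_r := fun X Y f => comp_id_r f |}.

Definition inclusion (C : Category) (P : C -> Prop) :
    Functor (full_subcategory P) C :=
  {| fobj := fun X : full_subcategory P => proj1_sig X;
     fmap := fun X Y f => f;
     fmap_id := fun X => eq_refl;
     fmap_comp := fun X Y Z g f => eq_refl |}.

Definition is_iso (C : Category) (X Y : C) (f : Hom X Y) : Prop :=
  exists g : Hom Y X, g ∘ f = id X /\ f ∘ g = id Y.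

Definition reflects_isos (C D : Category) (F : Functor C D) : Prop :=
  forall (X Y : C) (f : Hom X Y), is_iso (fmap F f) -> is_iso f.

Definition is_terminal (C : Category) (T : C) : Prop :=
  forall X : C, exists f : Hom X T, forall g : Hom X T, g = f.

(* The square  f ∘ p1 = g ∘ p2  on the cospan  f : X -> Z <- Y : g. *)
Definition is_pullback (C : Category) (X Y Z P : C)
    (f : Hom X Z) (g : Hom Y Z) (p1 : Hom P X) (p2 : Hom P Y) : Prop :=
  f ∘ p1 = g ∘ p2 /\
  forall (Q : C) (q1 : Hom Q X) (q2 : Hom Q Y), f ∘ q1 = g ∘ q2 ->
    exists! u : Hom Q P, p1 ∘ u = q1 /\ p2 ∘ u = q2.

Record Cone (J C : Category) (D : Functor J C) := {
  apex : C;
  leg : forall j : J, Hom apex (D j);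
  leg_natural : forall (i j : J) (a : Hom i j), fmap D a ∘ leg i = leg j
}.

Definition is_limit (J C : Category) (D : Functor J C) (K : Cone D) : Prop :=
  forall L : Cone D, exists! u : Hom (apex L) (apex K),
    forall j : J, leg K j ∘ u = leg L j.

Program Definition map_cone (J C E : Category) (F : Functor C E)
    (D : Functor J C) (K : Cone D) : Cone (functor_comp F D) :=
  {| apex := F (apex K); leg := fun j => fmap F (leg K j) |}.
Next Obligation. now rewrite <- fmap_comp, leg_natural. Qed.

Definition finite_category (J : Category) : Prop :=
  Finite J /\ forall i j : J, Finite (Hom i j).

Definition has_finite_limits (C : Category) : Prop :=
  forall J : Category, finite_category J ->
  forall D : Functor J C, exists K : Cone D, is_limit K.

Definition preserves_finite_limits (C E : Category) (F : Functor C E) : Prop :=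
  forall J : Category, finite_category J ->
  forall (D : Functor J C) (K : Cone D), is_limit K -> is_limit (map_cone F K).

Definition semi_left_exact (C M : Category) (I : Functor C M) (H : Functor M C)
    (adj : Adjunction I H) : Prop :=
  forall (X : C) (N : M) (g : Hom (H N) (H (I X)))
    (P : C) (p1 : Hom P X) (p2 : Hom P (H N)),
    is_pullback (unit adj X) g p1 p2 ->
    is_pullback (fmap I (unit adj X)) (fmap I g) (fmap I p1) (fmap I p2).

Definition simple (C M : Category) (I : Functor C M) (H : Functor M C)
    (adj : Adjunction I H) : Prop :=
  forall (A B : C) (f : Hom A B)
    (P : C) (p1 : Hom P B) (p2 : Hom P (H (I A))),
    is_pullback (unit adj B) (fmap H (fmap I f)) p1 p2 ->
    forall w : Hom A P, p1 ∘ w = f -> p2 ∘ w = unit adj A ->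
    is_iso (fmap I w).

(* Main.v *)
Require Import Defs.
From Stdlib Require Import FunctionalExtensionality ClassicalEpsilon.

(** The reflector inverts units, so semi-left-exactness says that [I] inverts
    every pullback [p2 : P -> H N] of a unit [X -> H (I X)] along a map
    [g : H N -> H (I X)].  Simplicity says this only for [g = H (I f)], where it
    amounts to inverting the comparison [w], since [p2 ∘ w] is a unit.  Hence
    semi-left-exactness implies simplicity.

    For the converse, let [p2 : P -> H N] be such a pullback.  As [U H] reflects
    isomorphisms, it suffices that [U H I p2] is a bijection of sets.

    It is surjective because [U] turns [p2] into a pullback of a surjection, and
    the components of [U η] are surjections
    ([pullback_of_unit_surjective_on_sets]).

    It is injective because elements of [U (H I P)] are, by (d), images of
    points [T -> H I P], which by (e) lift to points [T -> P]
    ([points_lift_along_unit]).  If two elements have the same image, then the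
    lifted points agree after [p2], because [U] is faithful on points of
    reflective objects ([points_faithful]).  Both lifted points then lie in a
    single fibre of [p2], and this fibre is the pullback of [η_X] along [H (I x)]
    for a point [x : T -> X].  Simplicity identifies the reflection of this
    fibre with [I T], so the two points become equal under [I]
    ([simple_equalizes_fibrewise]). *)

(** * Isomorphisms and pullbacks *)

Lemma iso_mono {C : Category} {X Y Z : C} (f : Hom Y Z) (u v : Hom X Y) :
  is_iso f -> f ∘ u = f ∘ v -> u = v.
Proof.
  intros [g [gf _]] E.
  now rewrite <- (comp_id_l u), <- (comp_id_l v), <- gf, <- !comp_assoc, E.
Qed.

Lemma iso_epi {C : Category} {X Y Z : C} (f : Hom X Y) (u v : Hom Y Z) :
  is_iso f -> u ∘ f = v ∘ f -> u = v.
Proof.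
  intros [g [_ fg]] E.
  now rewrite <- (comp_id_r u), <- (comp_id_r v), <- fg, !comp_assoc, E.
Qed.

Lemma iso_cancel_l {C : Category} {X Y Z : C} (g : Hom Y Z) (f : Hom X Y) :
  is_iso g -> is_iso (g ∘ f) -> is_iso f.
Proof.
  intros Hg [h [h1 h2]].
  exists (h ∘ g); split.
  - now rewrite <- comp_assoc.
  - apply (iso_mono g); [exact Hg|].
    now rewrite comp_id_r, !comp_assoc, h2, comp_id_l.
Qed.

Lemma iso_cancel_r {C : Category} {X Y Z : C} (g : Hom Y Z) (f : Hom X Y) :
  is_iso f -> is_iso (g ∘ f) -> is_iso g.
Proof.
  intros Hf [h [h1 h2]].
  exists (f ∘ h); split.
  - apply (iso_epi f); [exact Hf|].
    now rewrite comp_id_l, <- !comp_assoc, h1, comp_id_r.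
  - now rewrite comp_assoc.
Qed.

Lemma pullback_of_iso {C : Category} {X Y Z P : C} (f : Hom X Z) (g : Hom Y Z)
    (p1 : Hom P X) (p2 : Hom P Y) :
  is_iso f -> is_pullback f g p1 p2 -> is_iso p2.
Proof.
  intros [h [hf fh]] [E pb].
  assert (E' : f ∘ (h ∘ g) = g ∘ id Y)
    by now rewrite comp_assoc, fh, comp_id_l, comp_id_r.
  destruct (pb Y (h ∘ g) (id Y) E') as [s [[s1 s2] _]].
  exists s; split; [|exact s2].
  destruct (pb P p1 p2 E) as [u [_ uniq]].
  transitivity u; [symmetry|]; apply uniq; split.
  - now rewrite comp_assoc, s1, <- comp_assoc, <- E, comp_assoc, hf, comp_id_l.
  - now rewrite comp_assoc, s2, comp_id_l.
  - apply comp_id_r.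
  - apply comp_id_r.
Qed.

Lemma iso_square_pullback {C : Category} {X Y Z P : C} (f : Hom X Z)
    (g : Hom Y Z) (p1 : Hom P X) (p2 : Hom P Y) :
  is_iso f -> is_iso p2 -> f ∘ p1 = g ∘ p2 -> is_pullback f g p1 p2.
Proof.
  intros Hf [s [sp ps]] E; split; [exact E|].
  intros Q q1 q2 Eq; exists (s ∘ q2); repeat split.
  - apply (iso_mono f); [exact Hf|].
    now rewrite !comp_assoc, E, <- (comp_assoc g), ps, comp_id_r.
  - now rewrite comp_assoc, ps, comp_id_l.
  - intros u [_ <-]. now rewrite comp_assoc, sp, comp_id_l.
Qed.

Lemma set_bijection_iso {A B : SET} (f : Hom A B) :
  Injective f -> Surjective f -> is_iso f.
Proof.
  intros inj surj.
  exists (fun b => proj1_sig (constructive_indefinite_description _ (surj b))).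
  split; apply functional_extensionality; intros x; cbn;
    destruct constructive_indefinite_description as [a Ha]; cbn; auto.
Qed.

(** * Terminal objects and pullbacks as finite limits *)

Inductive cospan_shape := cospan_left | cospan_right | cospan_corner.

Definition cospan_hom (i j : cospan_shape) : Set :=
  match i, j with
  | cospan_left, cospan_right | cospan_right, cospan_left
  | cospan_corner, cospan_left | cospan_corner, cospan_right => Empty_set
  | _, _ => Datatypes.unit
  end.

Definition cospan_comp (i j k : cospan_shape) :
    cospan_hom j k -> cospan_hom i j -> cospan_hom i k.
Proof. destruct i, j, k; cbn; first [tauto | intros []; tauto]. Defined.

Definition cospan_category : Category.
Proof.
  refine {| Ob := cospan_shape; Hom := cospan_hom;
            id := fun i => match i with
                           | cospan_left | cospan_right | cospan_corner => tt
                           end;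
            comp := cospan_comp |}.
  - intros [] [] [] []; cbn; intros [] [] []; reflexivity.
  - intros [] []; cbn; intros []; reflexivity.
  - intros [] []; cbn; intros []; reflexivity.
Defined.

Lemma cospan_finite : finite_category cospan_category.
Proof.
  split.
  - exists (cospan_left :: cospan_right :: cospan_corner :: nil)%list.
    intros []; cbn; tauto.
  - intros [] [];
      first [ exists (tt :: nil)%list; intros []; cbn; tauto
            | exists nil; intros [] ].
Qed.

Definition arrow_left : @Hom cospan_category cospan_left cospan_corner := tt.
Definition arrow_right : @Hom cospan_category cospan_right cospan_corner := tt.

Definition cospan_diagram {C : Category} {X Y Z : C} (f : Hom X Z)
    (g : Hom Y Z) : Functor cospan_category C.
Proof.
  refine {| fobj := fun i : cospan_category => match i with
                    | cospan_left => X
                    | cospan_right => Y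
                    | cospan_corner => Z
                    end;
            fmap := fun i j => match i, j with
                    | cospan_left, cospan_left => fun _ => id X
                    | cospan_right, cospan_right => fun _ => id Y
                    | cospan_corner, cospan_corner => fun _ => id Z
                    | cospan_left, cospan_corner => fun _ => f
                    | cospan_right, cospan_corner => fun _ => g
                    | _, _ => fun a => match a with end
                    end |}.
  - intros []; reflexivity.
  - intros [] [] []; cbn; intros [] [];
      now rewrite ?comp_id_l, ?comp_id_r.
Defined.

Definition cospan_cone {C : Category} (D : Functor cospan_category C) (Q : C)
    (q1 : Hom Q (D cospan_left)) (q2 : Hom Q (D cospan_right))
    (E : fmap D arrow_left ∘ q1 = fmap D arrow_right ∘ q2) : Cone D.
Proof.
  refine (@Build_Cone cospan_category C D Q
    (fun i => match i with
              | cospan_left => q1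
              | cospan_right => q2
              | cospan_corner => fmap D arrow_left ∘ q1
              end) _).
  intros [] []; cbn; intros [];
    first [ reflexivity
          | now symmetry
          | etransitivity; [|apply comp_id_l];
            apply (f_equal (fun h => h ∘ _)); exact (fmap_id D _) ].
Defined.

(** Stated for an arbitrary cospan-shaped diagram, so that it applies both to
    [cospan_diagram f g] and to its image under a functor. *)
Lemma cospan_limit_iff_pullback {C : Category} (D : Functor cospan_category C)
    (K : Cone D) :
  is_limit K <->
  is_pullback (fmap D arrow_left) (fmap D arrow_right)
    (leg K cospan_left) (leg K cospan_right).
Proof.
  assert (corner : forall L : Cone D,
    fmap D arrow_left ∘ leg L cospan_left
    = fmap D arrow_right ∘ leg L cospan_right)
    by (intros L; now rewrite !leg_natural).
  split.
  - intros lim; split; [apply corner|].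
    intros Q q1 q2 E.
    destruct (lim (cospan_cone D Q q1 q2 E)) as [u [Hu uniq]].
    exists u; split.
    + split; [exact (Hu cospan_left) | exact (Hu cospan_right)].
    + intros v [v1 v2]; apply uniq; intros []; cbn; auto.
      now rewrite <- v1, comp_assoc, leg_natural.
  - intros [_ pb] L.
    destruct (pb _ _ _ (corner L)) as [u [[u1 u2] uniq]].
    exists u; split.
    + intros []; auto.
      now rewrite <- (leg_natural K arrow_left), <- comp_assoc, u1, leg_natural.
    + intros v Hv; apply uniq; split; apply Hv.
Qed.

Lemma pullbacks_exist {C : Category} (lim : has_finite_limits C) {X Y Z : C}
    (f : Hom X Z) (g : Hom Y Z) :
  exists (P : C) (p1 : Hom P X) (p2 : Hom P Y), is_pullback f g p1 p2.
Proof.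
  destruct (lim _ cospan_finite (cospan_diagram f g)) as [K HK].
  apply cospan_limit_iff_pullback in HK.
  exact (ex_intro _ _ (ex_intro _ _ (ex_intro _ _ HK))).
Qed.

Lemma pullbacks_preserved {C E : Category} (U : Functor C E)
    (pres : preserves_finite_limits U) {X Y Z P : C} (f : Hom X Z) (g : Hom Y Z)
    (p1 : Hom P X) (p2 : Hom P Y) :
  is_pullback f g p1 p2 ->
  is_pullback (fmap U f) (fmap U g) (fmap U p1) (fmap U p2).
Proof.
  intros pb.
  pose (K := cospan_cone (cospan_diagram f g) P p1 p2 (proj1 pb)).
  assert (HK : is_limit K) by (apply cospan_limit_iff_pullback; exact pb).
  apply (pres _ cospan_finite) in HK.
  exact (proj1 (cospan_limit_iff_pullback _ _) HK).
Qed.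

Lemma set_pullback_exists {X Y Z P : SET} (f : Hom X Z) (g : Hom Y Z)
    (p1 : Hom P X) (p2 : Hom P Y) (x : X) (y : Y) :
  is_pullback f g p1 p2 -> f x = g y -> exists z, p1 z = x /\ p2 z = y.
Proof.
  intros [_ pb] E.
  destruct (pb Datatypes.unit (fun _ => x) (fun _ => y)) as [u [[u1 u2] _]].
  - cbn; now rewrite E.
  - exists (u tt); split; [exact (equal_f u1 tt) | exact (equal_f u2 tt)].
Qed.

Lemma set_pullback_unique {X Y Z P : SET} (f : Hom X Z) (g : Hom Y Z)
    (p1 : Hom P X) (p2 : Hom P Y) (z z' : P) :
  is_pullback f g p1 p2 -> p1 z = p1 z' -> p2 z = p2 z' -> z = z'.
Proof.
  intros [E pb] E1 E2.
  destruct (pb Datatypes.unit (fun _ => p1 z) (fun _ => p2 z)) as [u [_ uniq]].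
  - apply functional_extensionality; intros ?; exact (equal_f E z).
  - transitivity (u tt); [symmetry|].
    + apply (equal_f (uniq (fun _ => z) (conj eq_refl eq_refl)) tt).
    + apply (equal_f (f := u) (g := fun _ => z')).
      apply uniq; split; cbn; [now rewrite E1 | now rewrite E2].
Qed.

Definition empty_category : Category.
Proof.
  refine {| Ob := Empty_set; Hom := fun _ _ => Empty_set;
            id := fun i => match i with end;
            comp := fun i _ _ _ _ => match i with end |}; intros [].
Defined.

Definition empty_diagram (C : Category) : Functor empty_category C.
Proof.
  refine {| fobj := fun i : empty_category => match i with end;
            fmap := fun i _ _ => match i with end |}; intros [].
Defined.

Definition empty_cone {C : Category} (D : Functor empty_category C) (X : C) :
  Cone D.
Proof.
  refine (@Build_Cone empty_category C D X (fun i => match i with end) _).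
  intros [].
Defined.

Lemma terminal_preserved {C E : Category} (U : Functor C E)
    (pres : preserves_finite_limits U) (T : C) :
  is_terminal T -> is_terminal (U T).
Proof.
  intros term.
  assert (fin : finite_category empty_category)
    by (split; [exists nil; intros [] | intros []]).
  assert (HK : is_limit (empty_cone (empty_diagram C) T)).
  { intros L; destruct (term (apex L)) as [t Ht].
    exists t; split; [intros []|]. intros u _; symmetry; apply Ht. }
  apply (pres _ fin) in HK.
  intros X; destruct (HK (empty_cone _ X)) as [u [_ uniq]].
  exists u; intros v; symmetry; apply uniq; intros [].
Qed.

Lemma set_terminal_singleton {A : SET} :
  is_terminal A -> exists a : A, forall b : A, b = a.
Proof.
  intros term; destruct (term Datatypes.unit) as [t Ht].
  exists (t tt); intros b.
  exact (equal_f (Ht (fun _ => b)) tt).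
Qed.

(** * Reflections along a full functor *)

(** [eta] and [eps] are the unit and counit with the identity and composite
    functors in their sources and targets already evaluated, so that their
    equations rewrite syntactically. *)
Definition eta {C M : Category} {I : Functor C M} {H : Functor M C}
  (adj : Adjunction I H) (X : C) : Hom X (H (I X)) := unit adj X.

Definition eps {C M : Category} {I : Functor C M} {H : Functor M C}
  (adj : Adjunction I H) (N : M) : Hom (I (H N)) N := counit adj N.

Lemma eta_natural {C M : Category} {I : Functor C M} {H : Functor M C}
    (adj : Adjunction I H) {X Y : C} (f : Hom X Y) :
  fmap H (fmap I f) ∘ eta adj X = eta adj Y ∘ f.
Proof. symmetry; exact (naturality (unit adj) f). Qed.

Lemma eps_natural {C M : Category} {I : Functor C M} {H : Functor M C}
    (adj : Adjunction I H) {N N' : M} (f : Hom N N') :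
  eps adj N' ∘ fmap I (fmap H f) = f ∘ eps adj N.
Proof. exact (naturality (counit adj) f). Qed.

Lemma eps_eta {C M : Category} {I : Functor C M} {H : Functor M C}
    (adj : Adjunction I H) (X : C) :
  eps adj (I X) ∘ fmap I (eta adj X) = id (I X).
Proof. exact (triangle_l adj X). Qed.

Lemma eta_eps {C M : Category} {I : Functor C M} {H : Functor M C}
    (adj : Adjunction I H) (N : M) :
  fmap H (eps adj N) ∘ eta adj (H N) = id (H N).
Proof. exact (triangle_r adj N). Qed.

Lemma transpose_injective {C M : Category} {I : Functor C M} {H : Functor M C}
    (adj : Adjunction I H) {X : C} {N : M} (u v : Hom (I X) N) :
  fmap H u ∘ eta adj X = fmap H v ∘ eta adj X -> u = v.
Proof.
  assert (untranspose : forall k : Hom (I X) N,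
    eps adj N ∘ fmap I (fmap H k ∘ eta adj X) = k).
  { intros k.
    now rewrite fmap_comp, comp_assoc, eps_natural, <- comp_assoc, eps_eta,
      comp_id_r. }
  intros E; now rewrite <- (untranspose u), <- (untranspose v), E.
Qed.

Definition full {C M : Category} (H : Functor M C) : Prop :=
  forall (N N' : M) (h : Hom (H N) (H N')), exists k, fmap H k = h.

(** Precomposition with the unit is injective on maps between objects in the
    image of [H], because fullness writes them as images under [H]. *)
Lemma unit_epi {C M : Category} {I : Functor C M} {H : Functor M C}
    (adj : Adjunction I H) (Hfull : full H) {X : C} {N : M}
    (u v : Hom (H (I X)) (H N)) :
  u ∘ eta adj X = v ∘ eta adj X -> u = v.
Proof.
  destruct (Hfull _ _ u) as [u' <-], (Hfull _ _ v) as [v' <-].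
  intros E; now rewrite (transpose_injective adj u' v' E).
Qed.

Lemma extend_along_unit {C M : Category} {I : Functor C M} {H : Functor M C}
    (adj : Adjunction I H) {X : C} {N : M} (f : Hom X (H N)) :
  exists k : Hom (I X) N, fmap H k ∘ eta adj X = f.
Proof.
  exists (eps adj N ∘ fmap I f).
  now rewrite fmap_comp, <- comp_assoc, eta_natural, comp_assoc, eta_eps,
    comp_id_l.
Qed.

(** The other composite [η_X ∘ r] is an endomorphism of [H (I X)], so it may be
    compared with the identity after [η_X]. *)
Lemma unit_iso_of_retraction {C M : Category} {I : Functor C M}
    {H : Functor M C} (adj : Adjunction I H) (Hfull : full H) {X : C}
    (r : Hom (H (I X)) X) :
  r ∘ eta adj X = id X -> is_iso (eta adj X).
Proof.
  intros E; exists r; split; [exact E|].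
  apply (unit_epi adj Hfull).
  now rewrite <- comp_assoc, E, comp_id_r, comp_id_l.
Qed.

Lemma unit_iso_on_reflective {C M : Category} {I : Functor C M}
    {H : Functor M C} (adj : Adjunction I H) (Hfull : full H) (N : M) :
  is_iso (eta adj (H N)).
Proof.
  exact (unit_iso_of_retraction adj Hfull _ (eta_eps adj N)).
Qed.

Lemma reflector_inverts_unit {C M : Category} {I : Functor C M}
    {H : Functor M C} (adj : Adjunction I H) (Hfull : full H) (X : C) :
  is_iso (fmap I (eta adj X)).
Proof.
  exists (eps adj (I X)); split; [apply eps_eta|].
  apply (transpose_injective adj).
  (* Both [H (I η)] and [η_{H I X}] extend the same map along [η_X]. *)
  assert (E : fmap H (fmap I (eta adj X)) = eta adj (H (I X))).
  { apply (unit_epi adj Hfull), eta_natural. }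
  now rewrite fmap_comp, <- comp_assoc, eta_eps, fmap_id, comp_id_l, comp_id_r, E.
Qed.

(** * Semi-left-exactness and simplicity *)

Lemma semi_left_exact_simple {C M : Category} {I : Functor C M}
    {H : Functor M C} (adj : Adjunction I H) (Hfull : full H) :
  semi_left_exact adj -> simple adj.
Proof.
  intros sle A B f P p1 p2 pb w _ E2.
  apply (iso_cancel_l (fmap I p2)).
  - exact (pullback_of_iso _ _ _ _ (reflector_inverts_unit adj Hfull B)
             (sle B (I A) (fmap H (fmap I f)) P p1 p2 pb)).
  - rewrite <- fmap_comp, E2; exact (reflector_inverts_unit adj Hfull A).
Qed.

(** The side of the image square parallel to [I p2] is [I η_X], which is always
    invertible. *)
Lemma semi_left_exact_of_inverted {C M : Category} {I : Functor C M}
    {H : Functor M C} (adj : Adjunction I H) (Hfull : full H) :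
  (forall (X : C) (N : M) (g : Hom (H N) (H (I X)))
     (P : C) (p1 : Hom P X) (p2 : Hom P (H N)),
     is_pullback (eta adj X) g p1 p2 -> is_iso (fmap I p2)) ->
  semi_left_exact adj.
Proof.
  intros inv X N g P p1 p2 pb.
  apply iso_square_pullback.
  - exact (reflector_inverts_unit adj Hfull X).
  - exact (inv X N g P p1 p2 pb).
  - rewrite <- !fmap_comp; exact (f_equal (fmap I) (proj1 pb)).
Qed.

(** Let [α] and [β] have the same composite with [p2], and put [x = p1 ∘ α].
    Both factor through the pullback [Q] of [η_X] along [H (I x)], by maps [a]
    and [b] over [η_A].  Simplicity makes [I a] invertible, hence also [I q2],
    because [I q2 ∘ I a] is the isomorphism [I η_A].  As [I q2 ∘ I b] is also
    [I η_A], it follows that [I a = I b]. *)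
Lemma simple_equalizes_fibrewise {C M : Category} {I : Functor C M}
    {H : Functor M C} (adj : Adjunction I H) (Hfull : full H)
    (lim : has_finite_limits C) (Hsimple : simple adj)
    {X : C} {N : M} {g : Hom (H N) (H (I X))}
    {P : C} {p1 : Hom P X} {p2 : Hom P (H N)}
    (pb : is_pullback (eta adj X) g p1 p2)
    {A : C} (alpha beta : Hom A P) :
  p2 ∘ alpha = p2 ∘ beta -> fmap I alpha = fmap I beta.
Proof.
  intros E.
  pose proof pb as [sq univ].
  set (x := p1 ∘ alpha).
  destruct (pullbacks_exist lim (eta adj X) (fmap H (fmap I x)))
    as [Q [q1 [q2 pbQ]]].
  pose proof pbQ as [sqQ univQ].
  destruct (extend_along_unit adj (p2 ∘ alpha)) as [t Ht].
  assert (gt : g ∘ fmap H t = fmap H (fmap I x)).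
  { apply (unit_epi adj Hfull). unfold x.
    now rewrite <- comp_assoc, Ht, eta_natural, !comp_assoc, sq. }
  (* [k] sends the fibre [Q] into [P]. *)
  destruct (univ Q q1 (fmap H t ∘ q2)) as [k [[k1 k2] _]];
    [now rewrite comp_assoc, gt|].
  assert (lift : forall gamma : Hom A P, p2 ∘ gamma = p2 ∘ alpha ->
    exists c : Hom A Q, q1 ∘ c = p1 ∘ gamma /\ q2 ∘ c = eta adj A
      /\ k ∘ c = gamma).
  { intros gamma Eg.
    assert (sqg : eta adj X ∘ (p1 ∘ gamma)
                  = fmap H (fmap I x) ∘ eta adj A).
    { rewrite eta_natural. unfold x.
      now rewrite !comp_assoc, sq, <- !comp_assoc, Eg. }
    destruct (univQ A _ _ sqg) as [c [[c1 c2] _]].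
    exists c; repeat split; trivial.
    assert (sqP : eta adj X ∘ (p1 ∘ gamma) = g ∘ (p2 ∘ gamma))
      by now rewrite !comp_assoc, sq.
    destruct (univ A _ _ sqP) as [u [_ uniq]].
    transitivity u; [symmetry|]; apply uniq; split; trivial.
    - now rewrite comp_assoc, k1.
    - now rewrite comp_assoc, k2, <- comp_assoc, c2, Ht. }
  destruct (lift alpha eq_refl) as [a [a1 [a2 ka]]].
  destruct (lift beta (eq_sym E)) as [b [b1 [b2 kb]]].
  assert (Ia : is_iso (fmap I a))
    by exact (Hsimple A X x Q q1 q2 pbQ a a1 a2).
  assert (Iq2 : is_iso (fmap I q2)).
  { apply (iso_cancel_r _ (fmap I a)); [exact Ia|].
    rewrite <- fmap_comp, a2; apply reflector_inverts_unit, Hfull. }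
  rewrite <- ka, <- kb, !fmap_comp. f_equal.
  apply (iso_mono (fmap I q2)); [exact Iq2|].
  now rewrite <- !fmap_comp, a2, b2.
Qed.

(** * Points and elements *)

(** Surjectivity of [I] on points, read through the bijection between maps
    [I T -> I X] and points [T -> H (I X)]. *)
Lemma points_lift_along_unit {C M : Category} {I : Functor C M}
    {H : Functor M C} (adj : Adjunction I H) {T : C}
    (I_points : forall X : C, Surjective (fun f : Hom T X => fmap I f))
    {X : C} (s : Hom T (H (I X))) :
  exists x : Hom T X, eta adj X ∘ x = s.
Proof.
  destruct (extend_along_unit adj s) as [k Hk].
  destruct (I_points X k) as [x Hx]; cbn in Hx.
  exists x; now rewrite <- eta_natural, Hx.
Qed.

(** The map [e] from the pullback [E] of [u] and [v] to [T] equalizes them.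
    When [U u = U v], both [U E] and [U T] are singletons, hence so are their
    quotients [U (H (I E))] and [U (H (I T))], and [I e] is invertible.  From
    [I u ∘ I e = I v ∘ I e] one gets [I u = I v], and [H N] is reflective. *)
Lemma points_faithful {C M : Category} {I : Functor C M} {H : Functor M C}
    (adj : Adjunction I H) (Hfull : full H) (U : Functor C SET)
    (lim : has_finite_limits C) (pres : preserves_finite_limits U)
    (refl : reflects_isos (functor_comp U H))
    (surj : forall X : C, Surjective (fmap U (eta adj X)))
    {T : C} (term : is_terminal T) {N : M} (u v : Hom T (H N)) :
  fmap U u = fmap U v -> u = v.
Proof.
  intros Euv.
  destruct (set_terminal_singleton (terminal_preserved U pres T term))
    as [pt Hpt].
  destruct (pullbacks_exist lim u v) as [E [e [e' pb]]].
  assert (ee : e' = e) by (destruct (term E) as [t Ht]; now rewrite (Ht e), (Ht e')).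
  subst e'.
  pose proof (pullbacks_preserved U pres _ _ _ _ pb) as pbU.
  destruct (set_pullback_exists _ _ _ _ pt pt pbU (equal_f Euv pt))
    as [z _].
  assert (Ie : is_iso (fmap I e)).
  { apply refl, set_bijection_iso.
    - intros a a' _.
      destruct (surj E a) as [y <-], (surj E a') as [y' <-].
      f_equal; apply (set_pullback_unique _ _ _ _ y y' pbU);
        now rewrite (Hpt (fmap U e y)), (Hpt (fmap U e y')).
    - intros c; exists (fmap U (eta adj E) z).
      destruct (surj T c) as [y <-].
      transitivity (fmap U (eta adj T) (fmap U e z)).
      + exact (equal_f (eq_trans (eq_sym (fmap_comp U _ _))
          (eq_trans (f_equal (fmap U) (eta_natural adj e)) (fmap_comp U _ _))) z).
      + now rewrite (Hpt y), (Hpt (fmap U e z)). }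
  assert (Iuv : fmap I u = fmap I v).
  { apply (iso_epi (fmap I e)); [exact Ie|].
    now rewrite <- !fmap_comp, (proj1 pb). }
  apply (iso_mono (eta adj (H N))); [apply unit_iso_on_reflective, Hfull|].
  now rewrite <- !eta_natural, Iuv.
Qed.

Lemma pullback_of_unit_surjective_on_sets {C M : Category} {I : Functor C M}
    {H : Functor M C} (adj : Adjunction I H) (U : Functor C SET)
    (pres : preserves_finite_limits U)
    (surj : forall X : C, Surjective (fmap U (eta adj X)))
    {X : C} {N : M} {g : Hom (H N) (H (I X))}
    {P : C} {p1 : Hom P X} {p2 : Hom P (H N)} :
  is_pullback (eta adj X) g p1 p2 ->
  Surjective (fmap U (fmap H (fmap I p2))).
Proof.
  intros pb c.
  destruct (surj (H N) c) as [y <-], (surj X (fmap U g y)) as [x Hx].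
  destruct (set_pullback_exists _ _ _ _ x y
              (pullbacks_preserved U pres _ _ _ _ pb) Hx) as [z [_ Hz]].
  exists (fmap U (eta adj P) z); rewrite <- Hz.
  exact (equal_f (eq_trans (eq_sym (fmap_comp U _ _))
    (eq_trans (f_equal (fmap U) (eta_natural adj p2)) (fmap_comp U _ _))) z).
Qed.

Lemma simple_semi_left_exact {C M : Category} {I : Functor C M}
    {H : Functor M C} (adj : Adjunction I H) (Hfull : full H)
    (U : Functor C SET) (T : C)
    (lim : has_finite_limits C) (term : is_terminal T)
    (pres : preserves_finite_limits U)
    (refl : reflects_isos (functor_comp U H))
    (surj : forall X : C, Surjective (fmap U (eta adj X)))
    (U_points : forall N : M, Surjective (fun f : Hom T (H N) => fmap U f))
    (I_points : forall X : C, Surjective (fun f : Hom T X => fmap I f)) :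
  simple adj -> semi_left_exact adj.
Proof.
  intros Hsimple; apply (semi_left_exact_of_inverted adj Hfull).
  intros X N g P p1 p2 pb.
  destruct (set_terminal_singleton (terminal_preserved U pres T term))
    as [pt _].
  apply refl, set_bijection_iso;
    [|exact (pullback_of_unit_surjective_on_sets adj U pres surj pb)].
  intros a b Eab.
  destruct (U_points (I P) (fun _ => a)) as [alpha Ha].
  destruct (U_points (I P) (fun _ => b)) as [beta Hb].
  destruct (points_lift_along_unit adj I_points alpha) as [alpha0 <-].
  destruct (points_lift_along_unit adj I_points beta) as [beta0 <-].
  assert (Ep : p2 ∘ alpha0 = p2 ∘ beta0).
  { apply (iso_mono (eta adj (H N))); [apply unit_iso_on_reflective, Hfull|].
    apply (points_faithful adj Hfull U lim pres refl surj term).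
    rewrite !comp_assoc, <- !(eta_natural adj p2), <- !comp_assoc.
    rewrite (fmap_comp U _ (eta adj P ∘ alpha0)).
    rewrite (fmap_comp U _ (eta adj P ∘ beta0)).
    cbn in Ha, Hb |- *; rewrite Ha, Hb.
    apply functional_extensionality; intros ?; exact Eab. }
  apply (simple_equalizes_fibrewise adj Hfull lim Hsimple pb) in Ep.
  assert (Eη : eta adj P ∘ alpha0 = eta adj P ∘ beta0)
    by now rewrite <- !eta_natural, Ep.
  cbn in Ha, Hb; rewrite Eη, Hb in Ha.
  exact (eq_sym (equal_f Ha pt)).
Qed.

Theorem theorem7p1 (C : Category) (inM : C -> Prop)
  (I : Functor C (full_subcategory inM))
  (adj : Adjunction I (inclusion inM))
  (U : Functor C SET)
  (T : C)
  (C_finite_limits : has_finite_limits C)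
  (T_terminal : is_terminal T)
  (U_finite_limits : preserves_finite_limits U)
  (UH_reflects_isos : reflects_isos (functor_comp U (inclusion inM)))
  (U_unit_surjective : forall X : C, Surjective (fmap U (unit adj X)))
  (U_points_surjective : forall N : full_subcategory inM,
    Surjective (fun f : Hom T (inclusion inM N) => fmap U f))
  (I_points_surjective : forall X : C,
    Surjective (fun f : Hom T X => fmap I f)) :
  semi_left_exact adj <-> simple adj.
Proof.
  assert (Hfull : full (inclusion inM)) by (intros N N' h; now exists h).
  split.
  - exact (semi_left_exact_simple adj Hfull).
  - exact (simple_semi_left_exact adj Hfull U T C_finite_limits T_terminal
             U_finite_limits UH_reflects_isos U_unit_surjective
             U_points_surjective I_points_surjective).
Qed.
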